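(* Let $p$ be a prime. The map $M\mapsto\mathcal{C}(M)$ is a lattice isomorphism from the set of all $p$-minor subsets of $\mathbb{N}_0$ (under intersection and union) to the set of all linearly closed clonoids on $\mathbb{Z}_p$ (under intersection and sum).
   Context: $\mathbb{N}=\{1,2,3,\dots\}$, $\mathbb{N}_0=\mathbb{N}\cup\{0\}$. A set $M\subseteq\mathbb{N}_0$ is a $p$-minor subset if $n-(p-1)\in M$ for all $n\in M$ with $n>p-1$. All operations considered have arity $n\ge1$. For sets $E,F$ of finitary operations on $\mathbb{Z}_p$, $EF:=\{f(g_1,\dots,g_n)\mid n,m\in\mathbb{N},\ f\in E \text{ } n\text{-ary},\ g_1,\dots,g_n\in F\text{ } m\text{-ary}\}$. $\mathcal{L}_{\mathbb{Z}_p}$ is the clone on $\mathbb{Z}_p$ generated by $+$. A nonempty set $C$ of finitary operations on $\mathbb{Z}_p$ is a linearly closed clonoid on $\mathbb{Z}_p$ if $\mathcal{L}_{\mathbb{Z}_p}C\subseteq C$ and $C\mathcal{L}_{\mathbb{Z}_p}\subseteq C$. The sum is $D_1+D_2:=\{f+g\mid n\in\mathbb{N},\ f\in D_1,\ g\in D_2,\ f,g\ n\text{-ary}\}$. Let $\mathbb{Z}_p[X]$ be the polynomial ring over $\mathbb{Z}_p$ in the variables $x_1,x_2,\dots$. $\mathbb{Z}_p^*[X]$ is the set of reduced polynomials: those in which every variable occurs with exponent at most $p-1$ in every monomial. For $f\in\mathbb{Z}_p[X]$, $\operatorname{TD}(f)$ is the set of total degrees of the monomials occurring in $f$ with nonzero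 coefficient ($\operatorname{TD}(0)=\emptyset$), $\operatorname{mI}(f)$ is the largest index $i$ such that $x_i$ occurs in $f$ (and $0$ if no variable occurs), and for $n\ge\operatorname{mI}(f)$, $n\geq 1$, $f^{\mathbb{Z}_p^n}:\mathbb{Z}_p^n\to\mathbb{Z}_p$ is the function induced by $f$. For a $p$-minor subset $M$, $$\mathcal{C}(M):=\{0^{\mathbb{Z}_p^n}\mid n\in\mathbb{N}\}\cup\{f^{\mathbb{Z}_p^n}\mid f\in\mathbb{Z}_p^*[X],\ n\ge\max(1,\operatorname{mI}(f)),\ \operatorname{TD}(f)\subseteq M\}.$$ *)

(* Defs.v *)
From HB Require Import structures.
From mathcomp Require Import all_boot all_order all_algebra.
From mathcomp Require Import finmap monalg.
From mathcomp Require Import boolp classical_sets functions.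

Set Implicit Arguments.
Unset Strict Implicit.
Unset Printing Implicit Defensive.

Import GRing.Theory.

Local Open Scope classical_set_scope.
Local Open Scope ring_scope.

(* The carrier [L] is a set in the type [T]; [meet] and [join] need only
   satisfy the lattice laws on [L]. *)
Record lattice_on (T : Type) (L : set T) (meet join : T -> T -> T) : Prop :=
  LatticeOn {
    meet_closed : forall x y, L x -> L y -> L (meet x y);
    join_closed : forall x y, L x -> L y -> L (join x y);
    meet_comm : forall x y, L x -> L y -> meet x y = meet y x;
    join_comm : forall x y, L x -> L y -> join x y = join y x;
    meet_assoc : forall x y z, L x -> L y -> L z ->
      meet x (meet y z) = meet (meet x y) z;
    join_assoc : forall x y z, L x -> L y -> L z ->
      join x (join y z) = join (join x y) z;
    meet_absorb : forall x y, L x -> L y -> meet x (join x y) = x;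
    join_absorb : forall x y, L x -> L y -> join x (meet x y) = x
  }.

Record lattice_isomorphism (T U : Type)
    (L : set T) (meetL joinL : T -> T -> T)
    (K : set U) (meetK joinK : U -> U -> U) (phi : T -> U) : Prop :=
  LatticeIsomorphism {
    iso_dom_lattice : lattice_on L meetL joinL;
    iso_cod_lattice : lattice_on K meetK joinK;
    iso_bij : set_bij L K phi;
    iso_meet : forall x y, L x -> L y -> phi (meetL x y) = meetK (phi x) (phi y);
    iso_join : forall x y, L x -> L y -> phi (joinL x y) = joinK (phi x) (phi y)
  }.

Definition minor_subset (p : nat) (M : set nat) : Prop :=
  forall n : nat, M n -> (p.-1 < n)%N -> M (n - p.-1)%N.

(* [op p n] is the type of n-ary operations on Z_p.  A set of finitary
   operations is given by its family of n.+1-ary parts, so that every arity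
   is positive. *)
Definition op (p n : nat) : Type := {ffun {ffun 'I_n -> 'F_p} -> 'F_p}.

Definition opset (p : nat) : Type := forall n : nat, set (op p n.+1).

Definition opset_sub (p : nat) (D1 D2 : opset p) : Prop :=
  forall n, D1 n `<=` D2 n.

Definition opset_nonempty (p : nat) (D : opset p) : Prop :=
  exists n, D n !=set0.

Definition opset_inter (p : nat) (D1 D2 : opset p) : opset p :=
  fun n => D1 n `&` D2 n.

Definition opset_sum (p : nat) (D1 D2 : opset p) : opset p :=
  fun n => [set h | exists f g : op p n.+1, [/\ D1 n f, D2 n g & h = f + g]].

Definition op_comp (p n m : nat) (f : op p n) (g : 'I_n -> op p m) : op p m :=
  [ffun x : {ffun 'I_m -> 'F_p} => f [ffun i => g i x]].

Definition opset_comp (p : nat) (E F : opset p) : opset p :=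
  fun m => [set h | exists (n : nat) (f : op p n.+1) (g : 'I_n.+1 -> op p m.+1),
    [/\ E n f, forall i, F m (g i) & h = op_comp f g]].

Definition op_proj (p n : nat) (i : 'I_n) : op p n :=
  [ffun x : {ffun 'I_n -> 'F_p} => x i].

Definition op_add (p : nat) : op p 2 :=
  [ffun x : {ffun 'I_2 -> 'F_p} => x ord0 + x ord_max].

Definition is_clone (p : nat) (D : opset p) : Prop :=
  (forall n (i : 'I_n.+1), D n (op_proj p i)) /\ opset_sub (opset_comp D D) D.

Definition clone_generated (p : nat) (E : opset p) : opset p :=
  fun n => [set f | forall D, is_clone D -> opset_sub E D -> D n f].

(* [n = 1] is arity 2. *)
Inductive add_opset (p : nat) : opset p :=
  | AddOpset : add_opset (n := 1%N) (op_add p).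

Definition linear_clone (p : nat) : opset p := clone_generated (@add_opset p).

Arguments linear_clone : clear implicits.

Definition linearly_closed_clonoid (p : nat) (C : opset p) : Prop :=
  [/\ opset_nonempty C,
      opset_sub (opset_comp (linear_clone p) C) C
    & opset_sub (opset_comp C (linear_clone p)) C].

(* Z_p[X] is the monoid algebra over Z_p of the commutative monomials in
   variables indexed by [nat]; index [i] stands for x_(i+1). *)
Notation polyX p := {malg 'F_p[{cmonom nat}]}.

Definition reduced (p : nat) (f : polyX p) : Prop :=
  forall m : {cmonom nat}, m \in msupp f -> forall i : nat, (m i <= p.-1)%N.

Definition TD (p : nat) (f : polyX p) : set nat :=
  [set d | exists2 m : {cmonom nat}, m \in msupp f & mdeg m = d].

(* The shift by one turns the index [i] into the number of x_(i+1). *)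
Definition mI (p : nat) (f : polyX p) : nat :=
  (\max_(m <- msupp f) \max_(i <- finsupp (m : {cmonom nat})) i.+1)%N.

(* Used only for [mI f <= n], when every variable occurring in [f] is
   among x_1, ..., x_n. *)
Definition induced (p n : nat) (f : polyX p) : op p n :=
  [ffun x : {ffun 'I_n -> 'F_p} =>
     mmap idfun (fun m : {cmonom nat} => \prod_(i < n) x i ^+ m i) f].

Definition degree_clonoid (p : nat) (M : set nat) : opset p :=
  fun n => [set 0] `|`
    [set h | exists f : polyX p,
       [/\ reduced f, (mI f <= n.+1)%N, TD f `<=` M & h = induced n.+1 f]].

Arguments degree_clonoid : clear implicits.

(* Main.v *)
From HB Require Import structures.
From mathcomp Require Import all_boot all_order all_algebra.
From mathcomp Require Import finfield finmap monalg.
From mathcomp Require Import zify ring.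
From mathcomp Require Import boolp classical_sets functions.
Require Import Defs.

Set Implicit Arguments.
Unset Strict Implicit.
Unset Printing Implicit Defensive.

Import GRing.Theory.

Local Open Scope ring_scope.

(** Every operation on Z_p is induced by exactly one reduced polynomial, so it
    has well-defined coefficients at the reduced monomials x^a, and the
    operations in C(M) are those whose coefficients live in degrees belonging
    to M ([degree_clonoidP]).  In this description C turns intersections into
    intersections and unions into sums, and it is injective because every
    degree is the degree of some monomial.

    The clone generated by + consists of the linear forms ([linear_cloneP]).
    Hence a linearly closed clonoid is a family of subspaces, one for each
    arity, that is stable under linear substitutions.  If M is a p-minor subset
    then C(M) is such a family: a linear substitution into a monomial of degree
    d gives a product of d linear forms, which expands into monomials of degree
    d; reducing them with x^p = x lowers the degree by multiples of p - 1 and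
    keeps positive degrees positive, so the degree stays in M
    ([degree_clonoid_linear_subst]).

    The heart of the matter is that there are no other clonoids.  Let C be a
    linearly closed clonoid.  The dilations x_i -> l_i x_i separate the reduced
    monomials, so C contains every monomial that occurs in one of its members
    ([clonoid_xpow]) and is spanned by its monomials.  The substitution of
    x_j + x_i for x_j, followed by the extraction of one monomial, moves one
    unit of the exponent from x_j to x_i ([clonoid_move]).  Such moves connect
    any two monomials of the same degree, so that C is determined by the set of
    degrees of its monomials ([weights_xpow], [degree_clonoid_weights]).  The
    same move applied to x_1^(p-1) x_2 ... produces x_1^p, that is x_1, and so
    lowers the degree by p - 1: the set of degrees is a p-minor subset
    ([weights_minor]). *)

(** * Coefficients of an operation on Z_p *)

Lemma Fp_fermat (p : nat) (p_pr : prime p) (x : 'F_p) : x ^+ p = x.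
Proof. by have := expf_card x; rewrite card_Fp. Qed.

(** By Fermat, the polynomial of degree [p.-1] that is 1 at [t] and 0 at every
    other point. *)
Definition lagrange (p : nat) (t : 'F_p) : {poly 'F_p} :=
  1 - ('X - t%:P) ^+ p.-1.

Lemma size_lagrange (p : nat) (t : 'F_p) :
  (size (lagrange t) <= p.-1.+1)%N.
Proof.
apply: (leq_trans (size_polyD _ _)).
by rewrite geq_max size_poly1 size_polyN size_exp_XsubC leqnn.
Qed.

Lemma lagrangeE (p : nat) (p_pr : prime p) (t y : 'F_p) :
  (lagrange t).[y] = (y == t)%:R.
Proof.
rewrite /lagrange !hornerE; have [->|neq_yt] := eqVneq.
  by rewrite subrr expr0n -subn1 subn_eq0 leqNgt prime_gt1 // subr0.
apply/eqP; rewrite subr_eq0 eq_sym; apply/eqP.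
have nz : y - t != 0 by rewrite subr_eq0.
by apply: (mulfI nz); rewrite -exprS prednK ?prime_gt0 // Fp_fermat // mulr1.
Qed.

(** Dual to [lagrangeE]: interpolating the values of X^e at all the points of
    Z_p gives back X^e, because the two sides differ by a polynomial of degree
    less than p with p roots.  The bound on [e] is what makes this hold. *)
Lemma lagrange_interp (p : nat) (p_pr : prime p) (k : 'I_p.-1.+1) (e : nat) :
  (e <= p.-1)%N ->
  \sum_(t : 'F_p) (lagrange t)`_k * t ^+ e = (val k == e)%:R.
Proof.
move=> le_e; have p0 := prime_gt0 p_pr.
(* The claim compares the k-th coefficients in q = 0. *)
pose q : {poly 'F_p} := \sum_t (t ^+ e) *: lagrange t - 'X^e.
suff q0 : q = 0.
  have /(congr1 (fun r : {poly 'F_p} => r`_k)) := q0.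
  rewrite /q coefB coef_sum coefXn coef0 => /eqP; rewrite subr_eq0 => /eqP <-.
  by apply: eq_bigr => t _; rewrite coefZ mulrC.
apply/eqP/negPn/negP => /max_poly_roots /(_ (_ : all (root q) (enum 'F_p))).
move=> /(_ _ (enum_uniq _)); rewrite -cardE card_Fp // => H.
suff : (p < p)%N by rewrite ltnn.
apply: (leq_trans (H _)); last first.
  rewrite -[X in (_ <= X)%N](prednK p0) (leq_trans (size_polyD _ _)) // geq_max.
  rewrite size_polyN size_polyXn ltnS le_e andbT.
  apply: (leq_trans (size_sum _ _ _)); apply/bigmax_leqP => t _.
  exact: leq_trans (size_scale_leq _ _) (size_lagrange _).
apply/allP => y _; rewrite rootE /q hornerD hornerN hornerXn horner_sum.
rewrite (bigD1 y) //= big1 => [|t /negPf ne].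
  by rewrite hornerZ lagrangeE // eqxx mulr1 addr0 subrr.
by rewrite hornerZ lagrangeE // eq_sym ne mulr0.
Qed.

(** Exponent vectors of reduced monomials; the index type is ['I_p.-1.+1]
    instead of ['I_p], so that [inord] and [ord0] make sense without
    destructing [p]. *)
Definition expo (p n : nat) : predArgType := {ffun 'I_n -> 'I_p.-1.+1}.

Definition weight (p n : nat) (a : expo p n) : nat := (\sum_i a i)%N.

(** Exponents are unbounded here: substitutions produce unreduced monomials,
    which [xpow] below excludes. *)
Definition monof (p n : nat) (e : 'I_n -> nat) : op p n :=
  [ffun x : {ffun 'I_n -> 'F_p} => \prod_i x i ^+ e i].

Notation xpow a := (@monof _ _ (fun i => nat_of_ord (a i))).

Definition lag (p n : nat) (a : expo p n) (x : {ffun 'I_n -> 'F_p}) : 'F_p :=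
  \prod_i (lagrange (x i))`_(a i).

(** The coefficient of x^a in the reduced polynomial that induces [h], read
    off from multivariate Lagrange interpolation.  That this is the right
    number is the content of [coef_xpow] and [coef_expansion]. *)
Definition coef (p n : nat) (a : expo p n) (h : op p n) : 'F_p :=
  \sum_x lag a x * h x.

Lemma prod_nat_eq (R : comNzRingType) (n : nat) (e f : 'I_n -> nat) :
  \prod_i ((e i == f i)%:R : R) = [forall i, e i == f i]%:R.
Proof.
have [/forallP H|/forallPn [i /negPf ne]] := boolP [forall i, e i == f i].
  by rewrite big1 // => i _; rewrite H.
by rewrite (bigD1 i) //= ne mul0r.
Qed.

Lemma coef_monof_prod (p n : nat) (a : expo p n) (e : 'I_n -> nat) :
  coef a (monof p e) =
  \prod_i \sum_(t : 'F_p) (lagrange t)`_(a i) * t ^+ e i.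
Proof.
rewrite bigA_distr_bigA; apply: eq_bigr => x _.
by rewrite ffunE -big_split.
Qed.

Lemma coef_monof (p n : nat) (p_pr : prime p) (a : expo p n) (e : 'I_n -> nat) :
  (forall i, e i <= p.-1)%N ->
  coef a (monof p e) = [forall i, val (a i) == e i]%:R.
Proof.
move=> le_e; rewrite coef_monof_prod -prod_nat_eq; apply: eq_bigr => i _.
exact: lagrange_interp.
Qed.

Lemma coef_xpow (p n : nat) (p_pr : prime p) (a b : expo p n) :
  coef a (xpow b : op p n) = (a == b)%:R.
Proof.
rewrite coef_monof // => [|i]; last by rewrite -ltnS ltn_ord.
congr (_%:R); congr nat_of_bool; apply/forallP/eqP => [H|-> i //].
by apply/ffunP => i; apply/val_inj/eqP/H.
Qed.

Lemma lag_xpow (p n : nat) (p_pr : prime p) (x y : {ffun 'I_n -> 'F_p}) :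
  \sum_(a : expo p n) lag a x * (xpow a : op p n) y = (y == x)%:R.
Proof.
have -> : (y == x) = [forall i, y i == x i].
  by apply/eqP/eqfunP => [-> //|H]; apply/ffunP.
under eq_bigr do rewrite ffunE -big_split /=.
rewrite -(bigA_distr_bigA
  (fun i (k : 'I_p.-1.+1) => (lagrange (x i))`_k * y i ^+ k)).
transitivity (\prod_i ((y i == x i)%:R : 'F_p)).
  apply: eq_bigr => i _; rewrite -lagrangeE //.
  by rewrite (horner_coef_wide _ (size_lagrange _)).
exact: prod_nat_eq.
Qed.

(** The reduced monomials span all operations; with [coef_xpow] they form a
    basis with dual basis [coef]. *)
Lemma coef_expansion (p n : nat) (p_pr : prime p) (h : op p n) x :
  h x = \sum_(a : expo p n) coef a h * (xpow a : op p n) x.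
Proof.
under eq_bigr do rewrite mulr_suml.
rewrite exchange_big /= (bigD1 x) //= [X in _ + X]big1 => [|y ne_yx].
  under eq_bigr do rewrite mulrAC.
  by rewrite -mulr_suml lag_xpow // eqxx mul1r addr0.
under eq_bigr do rewrite mulrAC.
by rewrite -mulr_suml lag_xpow // eq_sym (negPf ne_yx) mul0r.
Qed.

Lemma coef0 (p n : nat) (a : expo p n) : coef a (0 : op p n) = 0.
Proof. by rewrite /coef big1 // => x _; rewrite ffunE mulr0. Qed.

Lemma coefD (p n : nat) (a : expo p n) (f g : op p n) :
  coef a (f + g) = coef a f + coef a g.
Proof. by rewrite -big_split; apply: eq_bigr => x _; rewrite ffunE mulrDr. Qed.

Lemma coef_lincomb (p n : nat) (I : finType) (a : expo p n) (c : I -> 'F_p)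
    (f : I -> op p n) :
  coef a [ffun x => \sum_i c i * f i x] = \sum_i c i * coef a (f i).
Proof.
rewrite /coef; under eq_bigr do rewrite ffunE mulr_sumr.
rewrite exchange_big; apply: eq_bigr => i _; rewrite mulr_sumr.
by apply: eq_bigr => x _; rewrite mulrCA.
Qed.

(** * Degree clonoids in terms of coefficients *)

Lemma mdeg_ord (n : nat) (m : {cmonom nat}) :
  (forall i, i \in finsupp m -> (i < n)%N) -> mdeg m = (\sum_(i < n) m i)%N.
Proof.
move=> supp; rewrite mdegE -(big_mkord xpredT (fun i => m i)).
rewrite [RHS](bigID (fun i => i \in finsupp m)) /= [X in (_ + X)%N]big1; last first.
  by move=> i; rewrite memNfinsupp => /eqP.
rewrite addn0 -[RHS]big_filter; apply: perm_big; apply: uniq_perm.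
- exact: fset_uniq.
- by rewrite filter_uniq // iota_uniq.
move=> i; rewrite mem_filter mem_index_iota /=.
by case: (boolP (i \in _)) => [/supp ->|].
Qed.

(** The formal monomial with exponent vector [a]; [insub] turns a variable
    index into an ordinal, and variables beyond the arity get exponent 0. *)
Definition cmono (p n : nat) (a : expo p n) : {cmonom nat} :=
  [cmonom oapp (fun j => val (a j)) 0%N (insub i) | i in seq_fset tt (iota 0 n)]%M.

Lemma cmonoE (p n : nat) (a : expo p n) (i : 'I_n) : cmono a i = a i.
Proof.
rewrite cmE fsfunE seq_fsetE mem_iota /= ltn_ord.
by rewrite insubT ?ltn_ord // => lt_in /=; congr (val (a _)); apply: val_inj.
Qed.

Lemma finsupp_cmono (p n : nat) (a : expo p n) (i : nat) :
  i \in finsupp (cmono a) -> (i < n)%N.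
Proof.
by rewrite mem_finsupp cmE fsfunE seq_fsetE mem_iota /=; case: ltnP; rewrite ?eqxx.
Qed.

Lemma coef_induced (p n : nat) (a : expo p n) (f : polyX p) :
  coef a (induced n f) = \sum_(m <- msupp f) f@_m * coef a (monof p (fun i => m i)).
Proof.
rewrite /coef; under eq_bigr do rewrite ffunE mmapE mulr_sumr.
rewrite exchange_big; apply: eq_bigr => m _; rewrite mulr_sumr.
by apply: eq_bigr => x _; rewrite mulrCA ffunE.
Qed.

(** Uniqueness of the reduced polynomial inducing an operation: it makes the
    existential over polynomials in [degree_clonoid] a condition on [coef].
    Everything after this lemma is about coefficients only. *)
Lemma degree_clonoidP (p : nat) (p_pr : prime p) (M : set nat) (n : nat)
    (h : op p n.+1) :
  degree_clonoid p M n h <->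
  (forall a : expo p n.+1, coef a h != 0 -> M (weight a)).
Proof.
split=> [[->|[f [red_f mI_f TD_f ->]]] a|supp_h].
- by rewrite coef0 eqxx.
- rewrite coef_induced => nz.
  have [m m_f am] : exists2 m, m \in msupp f & forall i, val (a i) = m (val i).
    apply: contrapT => noM; case/eqP: nz; apply: big1_seq => m /andP [_ m_f].
    rewrite coef_monof // => [|i]; last exact: red_f.
    have [/eqfunP am|] := boolP [forall i, val (a i) == m (val i)];
      last by rewrite mulr0.
    by case: noM; exists m.
  apply: TD_f; exists m => //; rewrite (@mdeg_ord n.+1) => [|i m_i].
    by apply: eq_bigr => i _; rewrite am.
  by apply: leq_trans mI_f; apply: (bigmaxn_sup_seq m); rewrite ?(bigmaxn_sup_seq i).
(* Only an upper bound on the support of this polynomial is needed, so the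
   injectivity of [cmono] never comes up. *)
right; pose f : polyX p := \sum_a << coef a h *g cmono a >>.
have supp_f m : m \in msupp f ->
    exists2 a : expo p n.+1, m = cmono a & coef a h != 0.
  rewrite -mcoeff_neq0 raddf_sum /= => nz.
  apply: contrapT => noA; case/eqP: nz; apply: big1 => a _.
  rewrite mcoeffU; case: eqP => [eq_m|]; last by rewrite mulr0n.
  have [->|nz] := eqVneq (coef a h) 0; first by rewrite mul0rn.
  by case: noA; exists a.
exists f; split.
- move=> m /supp_f [a -> _] i; have [lt_in|] := boolP (i \in finsupp (cmono a)).
    by rewrite (cmonoE a (Ordinal (finsupp_cmono lt_in))) -ltnS ltn_ord.
  by rewrite memNfinsupp => /eqP ->.
- apply/bigmax_leqP_seq => m /supp_f [a -> _] _.
  by apply/bigmax_leqP_seq => i /finsupp_cmono.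
- move=> _ [m /supp_f [a -> /supp_h Ma] <-].
  rewrite (mdeg_ord (@finsupp_cmono _ _ a)).
  by under eq_bigr do rewrite cmonoE.
apply/ffunP => x; rewrite (coef_expansion p_pr) ffunE raddf_sum /=.
apply: eq_bigr => a _; rewrite mmapU ffunE; congr (_ * _).
by apply: eq_bigr => i _; rewrite cmonoE.
Qed.

(** * Linear forms and the clone of addition *)

Definition linform (p n : nat) (c : 'I_n -> 'F_p) : op p n :=
  [ffun x : {ffun 'I_n -> 'F_p} => \sum_i c i * x i].

Definition linear_subst (p n m : nat) (f : op p n) (c : 'I_n -> 'I_m -> 'F_p) :
  op p m := op_comp f (fun i => linform (c i)).

Lemma linear_substE (p n m : nat) (f : op p n) (c : 'I_n -> 'I_m -> 'F_p) x :
  linear_subst f c x = f [ffun i => \sum_j c i j * x j].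
Proof. by rewrite ffunE; congr (f _); apply/ffunP => i; rewrite !ffunE. Qed.

Lemma linform_clone (p : nat) :
  is_clone (fun n => [set f : op p n.+1 | exists c, f = linform c]%classic).
Proof.
split=> [n i|m _ [n [_ [g [[c ->] g_lin ->]]]]].
  exists (fun j => (j == i)%:R); apply/ffunP => x; rewrite !ffunE.
  rewrite (bigD1 i) //= eqxx mul1r big1 ?addr0 // => j /negPf ->.
  by rewrite mul0r.
have [d gE] := choice g_lin.
exists (fun j => \sum_i c i * d i j); apply/ffunP => x; rewrite !ffunE.
under eq_bigr do rewrite ffunE gE ffunE mulr_sumr.
rewrite exchange_big; apply: eq_bigr => j _; rewrite mulr_suml.
by apply: eq_bigr => i _; rewrite mulrA.
Qed.

(** Linear forms are a clone containing +.  Conversely every c * x is a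
    repeated sum of projections, and 0, which is the empty sum, is also the sum
    of p copies of a projection. *)
Lemma linear_cloneP (p : nat) (p_pr : prime p) (n : nat) (f : op p n.+1) :
  linear_clone p n f <-> exists c, f = linform c.
Proof.
split=> [/(_ _ (@linform_clone p)) lin_f|[c ->] D [projD compD] addD].
  apply: lin_f => _ _ []; exists (fun=> 1); apply/ffunP => x; rewrite !ffunE.
  by rewrite !big_ord_recl big_ord0 !mul1r addr0; congr (_ + x _); apply: val_inj.
have DD g h : D n g -> D n h -> D n (g + h).
  move=> Dg Dh; apply: compD; exists 1%N, (op_add p).
  exists (fun i => if val i == 0%N then g else h).
  split; [exact: addD | by move=> i; case: ifP | ].
  by apply/ffunP => x; rewrite !ffunE.
have DM g k : (0 < k)%N -> D n g -> D n (g *+ k).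
  case: k => // k _ Dg; elim: k => [|k IHk]; first exact: Dg.
  by rewrite mulrS; exact: DD.
have pMn (g : op p n.+1) : g *+ p = 0.
  apply/ffunP => x; rewrite ffunMnE ffunE.
  exact: mulrn_pchar (pchar_Fp p_pr) _.
have D0 : D n 0.
  by rewrite -(pMn (op_proj p ord0)); apply: DM (prime_gt0 p_pr) (projD _ _).
have -> : linform c = \sum_i op_proj p i *+ (c i).
  apply/ffunP => x; rewrite ffunE sum_ffunE; apply: eq_bigr => i _.
  by rewrite ffunMnE ffunE -mulr_natl natr_Zp.
elim/big_ind: _ => // i _.
have [->|c_gt0] := posnP (nat_of_ord (c i)); first by rewrite mulr0n.
exact: DM c_gt0 (projD _ _).
Qed.

(** * Linearly closed clonoids contain the monomials of their members *)

Lemma clonoid_linear_subst (p : nat) (p_pr : prime p) (C : opset p)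
    (clC : linearly_closed_clonoid C) (n m : nat) (f : op p n.+1)
    (c : 'I_n.+1 -> 'I_m.+1 -> 'F_p) :
  C n f -> C m (linear_subst f c).
Proof.
move=> Cf; case: clC => _ _; apply; exists n, f, (fun i => linform (c i)).
by split=> // i; apply/(linear_cloneP p_pr); exists (c i).
Qed.

Lemma clonoid_lincomb_ord (p : nat) (p_pr : prime p) (C : opset p)
    (clC : linearly_closed_clonoid C) (n k : nat) (c : 'I_k.+1 -> 'F_p)
    (f : 'I_k.+1 -> op p n.+1) :
  (forall i, C n (f i)) -> C n [ffun x => \sum_i c i * f i x].
Proof.
move=> Cf; case: clC => _ LC _; apply: LC; exists k, (linform c), f.
split=> //; first by apply/(linear_cloneP p_pr); exists c.
by apply/ffunP => x; rewrite !ffunE; apply: eq_bigr => i _; rewrite ffunE.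
Qed.

Lemma clonoid0 (p : nat) (p_pr : prime p) (C : opset p)
    (clC : linearly_closed_clonoid C) (n : nat) : C n 0.
Proof.
have [[m [f Cf]] _ _] := clC.
have /(clonoid_linear_subst p_pr clC (fun=> fun=> 0)) Cg := Cf.
have := @clonoid_lincomb_ord p p_pr C clC n 0%N (fun=> 0) _ (fun=> Cg n).
by congr (C n); apply/ffunP => x; rewrite !ffunE big1 // => i _; rewrite mul0r.
Qed.

(** Only summands with a nonzero coefficient must belong to the clonoid; empty
    sums are covered because the clonoid contains 0. *)
Lemma clonoid_lincomb (p : nat) (p_pr : prime p) (C : opset p)
    (clC : linearly_closed_clonoid C) (n : nat) (I : finType) (c : I -> 'F_p)
    (f : I -> op p n.+1) :
  (forall i, c i != 0 -> C n (f i)) -> C n [ffun x => \sum_i c i * f i x].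
Proof.
move=> Cf; have C0 := clonoid0 p_pr clC n.
(* An extra zero summand in front makes the number of summands positive, as
   the arity of an operation has to be. *)
pose c' (i : 'I_#|I|.+1) := oapp (fun j => c (enum_val j)) 0 (unlift ord0 i).
pose f' (i : 'I_#|I|.+1) :=
  if c' i == 0 then 0 else oapp (fun j => f (enum_val j)) 0 (unlift ord0 i).
have Cf' i : C n (f' i).
  rewrite /f' /c'; case: eqVneq => // nz.
  by case: unliftP nz => [j _|_] /=; [exact: Cf|].
have := clonoid_lincomb_ord p_pr clC c' Cf'; congr (C n); apply/ffunP => x.
rewrite !ffunE big_ord_recl {1}/c' unlift_none mul0r add0r.
rewrite (reindex (@enum_val I predT)); last first.
  by apply: onW_bij; exact: enum_val_bij.
apply: eq_bigr => j _; rewrite /f' /c' liftK /=.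
by case: eqP => [->|//]; rewrite !mul0r.
Qed.


(** The torus of dilations x_i -> l_i x_i acts on x^b through the character
    l^b, and distinct reduced exponents give linearly independent functions of
    l.  Averaging f(l x) over l against the dual functional [lag a] therefore
    projects f onto its x^a component. *)
Lemma clonoid_xpow (p : nat) (p_pr : prime p) (C : opset p)
    (clC : linearly_closed_clonoid C) (n : nat) (f : op p n.+1)
    (a : expo p n.+1) :
  C n f -> coef a f != 0 -> C n (xpow a).
Proof.
move=> Cf nz.
pose dil (l : {ffun 'I_n.+1 -> 'F_p}) : op p n.+1 :=
  linear_subst f (fun i j => if i == j then l i else 0).
have dilE l x : dil l x =
    \sum_(b : expo p n.+1)
      coef b f * ((xpow b : op p n.+1) l * (xpow b : op p n.+1) x).
  rewrite /dil linear_substE (coef_expansion p_pr); apply: eq_bigr => b _.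
  congr (_ * _); rewrite !ffunE -big_split /=; apply: eq_bigr => i _.
  rewrite ffunE (bigD1 i) //= eqxx big1 ?addr0 ?exprMn // => j /negPf ne_ji.
  by rewrite eq_sym ne_ji mul0r.
have -> : xpow a = [ffun x => \sum_l ((coef a f)^-1 * lag a l) * dil l x].
  apply/ffunP => x; rewrite [RHS]ffunE.
  under eq_bigr do rewrite dilE -mulrA mulr_sumr.
  rewrite -mulr_sumr exchange_big /=.
  rewrite (eq_bigr (fun b => coef b f * (xpow b : op p n.+1) x * (a == b)%:R)).
    rewrite (bigD1 a) //= eqxx mulr1 big1 ?addr0 ?mulKf // => b /negPf ne.
    by rewrite eq_sym ne mulr0.
  move=> b _; rewrite -(coef_xpow p_pr) /coef mulr_sumr; apply: eq_bigr => l _.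
  by rewrite /=; ring.
apply: (clonoid_lincomb p_pr clC) => l _.
exact: (clonoid_linear_subst p_pr clC).
Qed.

Lemma clonoid_of_xpow (p : nat) (p_pr : prime p) (C : opset p)
    (clC : linearly_closed_clonoid C) (n : nat) (f : op p n.+1) :
  (forall a : expo p n.+1, coef a f != 0 -> C n (xpow a)) -> C n f.
Proof.
move=> Ca; have := clonoid_lincomb p_pr clC Ca; congr (C n).
by apply/ffunP => x; rewrite ffunE -coef_expansion.
Qed.

(** * Moving between monomials of a clonoid *)

(** Substituting x_j + x_i for x_j and extracting one monomial.  By the binomial
    theorem the part of degree a_j - 1 in x_j has coefficient a_j, which is
    nonzero mod p.  The exponent of x_i becomes a_i + 1, or 1 after reduction
    when a_i = p - 1; the hypothesis on [b i] covers both cases. *)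
Lemma clonoid_move (p : nat) (p_pr : prime p) (C : opset p)
    (clC : linearly_closed_clonoid C) (n : nat) (i j : 'I_n.+1)
    (a b : expo p n.+1) :
  i != j -> (0 < a j)%N -> val (b j) = (a j).-1 ->
  (forall x : 'F_p, x ^+ b i = x ^+ (a i).+1) ->
  (forall k, k != i -> k != j -> b k = a k) ->
  C n (xpow a) -> C n (xpow b).
Proof.
move=> ne_ij aj_gt0 bj bi bk Ca.
pose c (k l : 'I_n.+1) : 'F_p := (k == l)%:R + ((k == j) && (l == i))%:R.
pose e (t : nat) (k : 'I_n.+1) :=
  if k == j then (a j - t)%N else if k == i then (a i + t)%N else val (a k).
have substE : linear_subst (xpow a) c =
    [ffun x => \sum_(t < (a j).+1) 'C(a j, t)%:R * monof p (e t) x].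
  apply/ffunP => x; rewrite linear_substE !ffunE.
  have cE k : \sum_l c k l * x l = x k + (if k == j then x i else 0).
    under eq_bigr do rewrite mulrDl.
    rewrite big_split /= (bigD1 k) //= eqxx mul1r big1 ?addr0; last first.
      by move=> l /negPf ne; rewrite eq_sym ne mul0r.
    congr (_ + _); case: eqP => _ /=; last by rewrite big1 // => l _; rewrite mul0r.
    rewrite (bigD1 i) //= eqxx mul1r big1 ?addr0 // => l /negPf ->.
    by rewrite mul0r.
  rewrite (bigD1 j) //= ffunE cE eqxx exprDn mulr_suml; apply: eq_bigr => t _.
  rewrite ffunE [in RHS](bigD1 j) //= [in LHS](bigD1 i) //= [in RHS](bigD1 i) //=.
  have -> : e t j = (a j - t)%N by rewrite /e eqxx.
  have -> : e t i = (a i + t)%N by rewrite /e (negPf ne_ij) eqxx.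
  rewrite ffunE cE (negPf ne_ij) addr0.
  rewrite -mulr_natl exprD -!mulrA; congr (_ * (_ * _)).
  rewrite mulrCA; congr (_ * (_ * _)).
  apply: eq_bigr => k /andP [/negPf nj /negPf ni].
  by rewrite ffunE cE /e nj ni addr0.
apply: (clonoid_xpow p_pr clC (clonoid_linear_subst p_pr clC c Ca)).
have aj_lt : (a j < p)%N by rewrite -[X in (_ < X)%N](prednK (prime_gt0 p_pr)).
rewrite substE coef_lincomb.
have t1 : (1 < (a j).+1)%N by [].
rewrite (bigD1 (Ordinal t1)) //= big1 ?addr0 => [|t ne_t1].
  have -> : monof p (e 1%N) = xpow b.
    apply/ffunP => x; rewrite !ffunE; apply: eq_bigr => k _; rewrite /e.
    have [->|nj] := eqVneq k j; first by rewrite bj subn1.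
    by have [->|ni] := eqVneq k i; [rewrite bi addn1 | rewrite bk].
  rewrite coef_xpow // eqxx mulr1 bin1 -(dvdn_pcharf (pchar_Fp p_pr)).
  by rewrite gtnNdvd.
rewrite coef_monof_prod (bigD1 j) //= lagrange_interp //; last first.
  by rewrite /e eqxx (leq_trans (leq_subr _ _)) // -ltnS ltn_ord.
(* Terms with t different from 1 have another exponent at x_j, hence cannot
   contribute to the coefficient of x^b, whatever happens at x_i. *)
suff /negPf -> : val (b j) != e t j by rewrite mul0r mulr0.
rewrite bj /e eqxx; apply: contra_neq ne_t1 => eq_t; apply: val_inj => /=.
have := ltn_ord t; lia.
Qed.

Lemma eq_weight_le (p n : nat) (a b : expo p n) :
  weight a = weight b -> (forall i, (a i <= b i)%N) -> a = b.
Proof.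
move=> eq_w le_ab.
have [_] := leqif_sum (fun i (_ : predT i) => leqif_eq (le_ab i)).
rewrite -!/(weight _) eq_w eqxx => /esym/forallP eq_ab.
by apply/ffunP => i; apply/val_inj/eqP; have := eq_ab i.
Qed.

(** While a differs from b, some a_j exceeds b_j and, the weights being equal,
    some a_i is below b_i; [clonoid_move] then brings a closer to b.  Since
    a_i < b_i, the exponent of x_i needs no reduction. *)
Lemma clonoid_same_weight (p : nat) (p_pr : prime p) (C : opset p)
    (clC : linearly_closed_clonoid C) (n : nat) (a b : expo p n.+1) :
  weight a = weight b -> C n (xpow a) -> C n (xpow b).
Proof.
have [d] := ubnP (\sum_i (a i - b i))%N.
elim: d a => // d IHd a lt_ab_d eq_w Ca.
have [/forallP le_ab|/forallPn [j]] := boolP [forall i, (a i <= b i)%N].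
  by rewrite -(eq_weight_le eq_w le_ab).
rewrite -ltnNge => lt_j.
have [/forallP le_ba|/forallPn [i]] := boolP [forall i, (b i <= a i)%N].
  by move: lt_j; rewrite (eq_weight_le (esym eq_w) le_ba) ltnn.
rewrite -ltnNge => lt_i.
have ne_ij : i != j by apply: contraTneq lt_i => ->; lia.
pose a' : expo p n.+1 := [ffun k =>
  if k == j then inord (a j).-1 else if k == i then inord (a i).+1 else a k].
have aj : val (a' j) = (a j).-1.
  by rewrite ffunE eqxx /= inordK //; have := ltn_ord (a j); lia.
have ai : val (a' i) = (a i).+1.
  by rewrite ffunE (negPf ne_ij) eqxx /= inordK //; have := ltn_ord (b i); lia.
have ak k : k != i -> k != j -> a' k = a k.
  by move=> /negPf ki /negPf kj; rewrite ffunE kj ki.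
apply: (IHd a').
- move: lt_ab_d; rewrite (bigD1 j) //= (bigD1 i) //= [in X in _ -> X](bigD1 j) //=.
  rewrite [in X in _ -> X](bigD1 i) //= aj ai.
  under [in X in _ -> X]eq_bigr => k /andP [kj ki] do rewrite ak //.
  lia.
- rewrite -eq_w /weight (bigD1 j) //= (bigD1 i) //= [in RHS](bigD1 j) //=.
  rewrite [in RHS](bigD1 i) //= aj ai.
  under eq_bigr => k /andP [kj ki] do rewrite ak //.
  lia.
apply: (clonoid_move p_pr clC ne_ij _ aj _ ak Ca); first by lia.
by move=> x; rewrite ai.
Qed.

Lemma big_ord_trim (R : Type) (idx : R) (op : Monoid.law idx) (n N : nat)
    (F : nat -> R) :
  (n <= N)%N -> (forall i, n <= i -> F i = idx)%N ->
  \big[op/idx]_(i < N) F i = \big[op/idx]_(i < n) F i.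
Proof.
move=> le_nN F1; rewrite -!(big_mkord xpredT F) (big_cat_nat _ le_nN) //=.
rewrite [X in op _ X]big_nat_cond [X in op _ X]big1 ?Monoid.mulm1 // => i.
by rewrite andbT => /andP [/F1].
Qed.

(** Dropping or adding dummy variables is a linear substitution, which sends
    the variables absent from the target to 0. *)
Lemma clonoid_arity (p : nat) (p_pr : prime p) (C : opset p)
    (clC : linearly_closed_clonoid C) (s n m : nat) (e : nat -> nat)
    (a : expo p n.+1) (b : expo p m.+1) :
  (s <= n.+1)%N -> (s <= m.+1)%N -> (forall i, s <= i -> e i = 0)%N ->
  (forall i, val (a i) = e i) -> (forall i, val (b i) = e i) ->
  C n (xpow a) -> C m (xpow b).
Proof.
move=> le_sn le_sm e0 aE bE.
pose c (i : 'I_n.+1) (j : 'I_m.+1) : 'F_p := (val i == val j)%:R.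
move=> /(clonoid_linear_subst p_pr clC c); congr (C m).
apply/ffunP => x; rewrite linear_substE !ffunE.
pose y (i : nat) : 'F_p := oapp x 0 (insub i).
have y1 i : (s <= i)%N -> y i ^+ e i = 1 by move=> /e0 ->.
transitivity (\prod_(i < n.+1) y i ^+ e i).
  apply: eq_bigr => i _; rewrite ffunE aE; congr (_ ^+ _); rewrite /y.
  case: insubP => [j _ jE|].
    rewrite (bigD1 j) //= /c -[val i]jE eqxx mul1r big1 ?addr0 // => k ne_kj.
    by rewrite val_eqE eq_sym (negPf ne_kj) mul0r.
  move=> ge_m; rewrite big1 // => k _; rewrite /c.
  by case: eqP => [eq_ik|_]; rewrite ?mul0r //; move: ge_m; rewrite eq_ik ltn_ord.
transitivity (\prod_(i < m.+1) y i ^+ e i).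
  rewrite (@big_ord_trim _ _ _ s n.+1 (fun i => y i ^+ e i)) //.
  by rewrite (@big_ord_trim _ _ _ s m.+1 (fun i => y i ^+ e i)).
by apply: eq_bigr => i _; rewrite bE /y valK.
Qed.

(** The sequence of exponents of [a], continued by 0 beyond the arity. *)
Definition nexp (p n : nat) (a : expo p n) (i : nat) : nat :=
  oapp (fun k => val (a k)) 0%N (insub i).

Lemma nexpE (p n : nat) (a : expo p n) (i : 'I_n) : nexp a i = a i.
Proof. by rewrite /nexp valK. Qed.

Lemma nexp_ge (p n : nat) (a : expo p n) (i : nat) : (n <= i)%N -> nexp a i = 0%N.
Proof. by move=> le_ni; rewrite /nexp insubF // ltnNge le_ni. Qed.

Lemma nexp_le (p n : nat) (a : expo p n) (i : nat) : (nexp a i < p.-1.+1)%N.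
Proof. by rewrite /nexp; case: insub => //= k; exact: ltn_ord. Qed.

Definition pad (p n : nat) (a : expo p n) (N : nat) : expo p N :=
  [ffun i : 'I_N => inord (nexp a i)].

Lemma padE (p n N : nat) (a : expo p n) (i : 'I_N) : val (pad a N i) = nexp a i.
Proof. by rewrite ffunE /= inordK // nexp_le. Qed.

Lemma weight_pad (p n N : nat) (a : expo p n) :
  (n <= N)%N -> weight (pad a N) = weight a.
Proof.
move=> le_nN; rewrite /weight; under eq_bigr do rewrite padE.
rewrite (@big_ord_trim _ _ _ n N (nexp a)) //; last exact: nexp_ge.
by apply: eq_bigr => i _; rewrite nexpE.
Qed.

(** * Every linearly closed clonoid is a degree clonoid *)

(** The inverse of [degree_clonoid p]. *)
Definition weights (p : nat) (C : opset p) : set nat :=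
  [set d | exists (n : nat) (a : expo p n.+1), weight a = d /\ C n (xpow a)]%classic.

(** Membership of x^a depends on its degree only: pass from the monomial
    witnessing the degree to a common arity, change the exponents there, and
    come back. *)
Lemma weights_xpow (p : nat) (p_pr : prime p) (C : opset p)
    (clC : linearly_closed_clonoid C) (n : nat) (a : expo p n.+1) :
  weights C (weight a) <-> C n (xpow a).
Proof.
split=> [[m [b [eq_w Cb]]]|Ca]; last by exists n, a.
pose N := (n + m)%N.
have le_n : (n.+1 <= N.+1)%N by rewrite ltnS leq_addr.
have le_m : (m.+1 <= N.+1)%N by rewrite ltnS leq_addl.
have Cb' : C N (xpow (pad b N.+1)).
  apply: (clonoid_arity p_pr clC (leqnn _) le_m (@nexp_ge _ _ b) _ _ Cb) => i.
    by rewrite nexpE.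
  by rewrite padE.
have Ca' : C N (xpow (pad a N.+1)).
  by apply: (clonoid_same_weight p_pr clC _ Cb'); rewrite !weight_pad.
apply: (clonoid_arity p_pr clC le_n (leqnn _) (@nexp_ge _ _ a) _ _ Ca') => i.
  by rewrite padE.
by rewrite nexpE.
Qed.

Lemma degree_clonoid_weights (p : nat) (p_pr : prime p) (C : opset p)
    (clC : linearly_closed_clonoid C) :
  degree_clonoid p (weights C) = C.
Proof.
apply: functional_extensionality_dep => n; apply/seteqP; split=> f.
  move=> /(degree_clonoidP p_pr) wf; apply: (clonoid_of_xpow p_pr clC) => a nz.
  by apply/(weights_xpow p_pr clC)/wf.
move=> Cf; apply/(degree_clonoidP p_pr) => a nz.
exact/(weights_xpow p_pr clC)/(clonoid_xpow p_pr clC Cf nz).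
Qed.

(** x_1^k x_2 ... x_(d-k+1), of degree d.  The case k = 0 shows that every d is
    the degree of a monomial, the case k = p - 1 is used to lower a degree. *)
Definition standard_expo (p d k : nat) : expo p d.+1 :=
  [ffun i : 'I_d.+1 => if val i == 0%N then inord k else inord (i <= d - k)].

Lemma standard_expo0 (p d k : nat) :
  (k <= p.-1)%N -> val (standard_expo p d k ord0) = k.
Proof. by move=> le_k; rewrite ffunE /= inordK. Qed.

Lemma standard_expoS (p d k : nat) (p_pr : prime p) (i : 'I_d) :
  val (standard_expo p d k (lift ord0 i)) = (i < d - k)%N.
Proof.
rewrite ffunE /= inordK //; case: (i < d - k)%N => //=.
by have := prime_gt1 p_pr; lia.
Qed.

Lemma weight_standard (p d k : nat) (p_pr : prime p) :
  (k <= p.-1)%N -> (k <= d)%N -> weight (standard_expo p d k) = d.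
Proof.
move=> le_kp le_kd; rewrite /weight big_ord_recl standard_expo0 //.
under eq_bigr do rewrite standard_expoS //.
rewrite (@big_ord_trim _ _ _ (d - k) d (fun i => nat_of_bool (i < d - k)%N)).
- under eq_bigr do rewrite ltn_ord.
  by rewrite sum_nat_const card_ord muln1 subnKC.
- exact: leq_subr.
by move=> i; rewrite leqNgt => /negPf ->.
Qed.

(** Moving one degree from x_2 to x_1 in x_1^(p-1) x_2 ... turns x_1^(p-1) into
    x_1^p, which is x_1 as a function: the degree drops by p - 1. *)
Lemma weights_minor (p : nat) (p_pr : prime p) (C : opset p)
    (clC : linearly_closed_clonoid C) :
  minor_subset p (weights C).
Proof.
move=> d Cd lt_pd; have p_gt1 := prime_gt1 p_pr.
case: d => // d in Cd lt_pd *.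
pose a := standard_expo p d.+1 p.-1; pose j : 'I_d.+2 := lift ord0 ord0.
have wa : weight a = d.+1 by apply: weight_standard => //; lia.
have a0 : val (a ord0) = p.-1 by rewrite standard_expo0.
have aj : val (a j) = 1%N by rewrite standard_expoS //= subn_gt0 lt_pd.
pose b : expo p d.+2 :=
  [ffun k => if k == j then ord0 else if k == ord0 then inord 1 else a k].
have b0 : val (b ord0) = 1%N by rewrite ffunE /= inordK //; lia.
have bj : val (b j) = 0%N by rewrite ffunE eqxx.
have bk k : k != ord0 -> k != j -> b k = a k.
  by move=> /negPf k0 /negPf kj; rewrite ffunE kj k0.
exists d.+1, b; split.
  move: wa; rewrite /weight (bigD1 ord0) //= [in X in _ -> X](bigD1 ord0) //=.
  rewrite (bigD1 j) //= [in X in _ -> X](bigD1 j) //= a0 aj b0 bj.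
  under [in X in _ -> X]eq_bigr => k /andP [k0 kj] do rewrite bk //.
  lia.
rewrite -wa in Cd; move/(weights_xpow p_pr clC): Cd.
apply: (@clonoid_move p p_pr C clC _ ord0 j) => //.
- by rewrite aj.
- by rewrite bj aj.
move=> x; rewrite b0 a0 prednK ?prime_gt0 //.
by rewrite Fp_fermat.
Qed.

(** * Degree clonoids are linearly closed *)

Lemma exp_add_pred_mul (p : nat) (p_pr : prime p) (x : 'F_p) (k t : nat) :
  (0 < k)%N -> x ^+ (k + t * p.-1) = x ^+ k.
Proof.
case: k => // k _; elim: t => [|t IHt]; first by rewrite addn0.
rewrite -{}IHt.
have -> : (k.+1 + t.+1 * p.-1 = k + t * p.-1 + p)%N.
  by have := prime_gt0 p_pr; rewrite mulSn; lia.
by rewrite exprD Fp_fermat // -exprSr addSn.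
Qed.

(** Reduction lowers an exponent by a multiple of p - 1 but keeps positive
    exponents positive, since x^(p-1) and 1 differ at 0. *)
Lemma reduce_exponent (p : nat) (p_pr : prime p) (e : nat) :
  exists kt : 'I_p.-1.+1 * nat,
    [/\ e = (kt.1 + kt.2 * p.-1)%N, (0 < e)%N -> (0 < kt.1)%N
      & forall x : 'F_p, x ^+ e = x ^+ kt.1].
Proof.
have p1_gt0 : (0 < p.-1)%N by have := prime_gt1 p_pr; lia.
case: e => [|e]; first by exists (ord0, 0%N).
have lt_k : ((e %% p.-1).+1 < p.-1.+1)%N by rewrite ltnS ltn_mod.
have eE : (e.+1 = (e %% p.-1).+1 + e %/ p.-1 * p.-1)%N.
  by rewrite addSn addnC -divn_eq.
exists (Ordinal lt_k, (e %/ p.-1)%N); split=> // x.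
by rewrite [in LHS]eE exp_add_pred_mul.
Qed.

Lemma minor_subset_descend (p : nat) (M : set nat) (minM : minor_subset p M)
    (w t : nat) :
  (0 < w)%N -> M (w + t * p.-1)%N -> M w.
Proof.
move=> w_gt0; elim: t => [|t IHt]; first by rewrite addn0.
rewrite mulSn addnCA => /minM Mw; apply: IHt.
by rewrite addKn in Mw; apply: Mw; rewrite -ltn_subLR // subnn addn_gt0 w_gt0.
Qed.

Lemma degree_clonoid_lincomb (p : nat) (p_pr : prime p) (M : set nat) (n : nat)
    (I : finType) (c : I -> 'F_p) (f : I -> op p n.+1) :
  (forall i, c i != 0 -> degree_clonoid p M n (f i)) ->
  degree_clonoid p M n [ffun x => \sum_i c i * f i x].
Proof.
move=> Mf; apply/(degree_clonoidP p_pr) => a; rewrite coef_lincomb => nz.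
have [i] : exists i, c i * coef a (f i) != 0.
  apply: contrapT => no_i; case/eqP: nz; apply: big1 => i _.
  by apply/eqP/negPn/negP => nz_i; apply: no_i; exists i.
rewrite mulf_eq0 negb_or => /andP [/Mf/(degree_clonoidP p_pr) Mfi].
exact: Mfi.
Qed.

Lemma degree_clonoid_xpow (p : nat) (p_pr : prime p) (M : set nat) (n : nat)
    (a : expo p n.+1) :
  degree_clonoid p M n (xpow a) <-> M (weight a).
Proof.
split=> [/(degree_clonoidP p_pr)|Ma].
  by apply; rewrite coef_xpow // eqxx oner_eq0.
apply/(degree_clonoidP p_pr) => b; rewrite coef_xpow //.
by have [->|] := eqVneq b a; rewrite ?eqxx.
Qed.

(** The reduced form of the monomial has degree smaller by a multiple of
    p - 1, and still positive if it was positive; a minor subset is closed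
    under such a descent. *)
Lemma degree_clonoid_monof (p : nat) (p_pr : prime p) (M : set nat)
    (minM : minor_subset p M) (n : nat) (e : 'I_n.+1 -> nat) :
  M (\sum_i e i)%N -> degree_clonoid p M n (monof p e).
Proof.
move=> Me; have [kt ktP] := choice (fun i => reduce_exponent p_pr (e i)).
pose a : expo p n.+1 := [ffun i => (kt i).1].
have -> : monof p e = xpow a.
  apply/ffunP => x; rewrite !ffunE; apply: eq_bigr => i _.
  by rewrite ffunE; case: (ktP i).
apply/degree_clonoid_xpow => //.
have eE : (\sum_i e i = weight a + (\sum_i (kt i).2) * p.-1)%N.
  rewrite big_distrl -big_split; apply: eq_bigr => i _.
  by rewrite ffunE; case: (ktP i).
have [a0|a_gt0] := posnP (weight a); last first.
  by rewrite eE in Me; apply: minor_subset_descend Me.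
(* A vanishing reduced degree means that nothing was reduced. *)
suff e0 : (\sum_i e i = 0)%N by rewrite a0 -e0.
apply: big1 => i _; apply/eqP; rewrite -leqn0 leqNgt; apply/negP => e_gt0.
have [_ /(_ e_gt0) k_gt0 _] := ktP i.
by move: a0; rewrite /weight (bigD1 i) //= ffunE; lia.
Qed.

(** The monomial factor is an accumulator: expanding the first linear form
    moves one variable into it and keeps the total degree. *)
Lemma degree_clonoid_prod_linform (p : nat) (p_pr : prime p) (M : set nat)
    (minM : minor_subset p M) (n : nat) (s : seq ('I_n.+1 -> 'F_p))
    (e : 'I_n.+1 -> nat) :
  M (\sum_i e i + size s)%N ->
  degree_clonoid p M n
    [ffun x => monof p e x * \prod_(c <- s) linform c x].
Proof.
elim: s e => [|c s IHs] e Me.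
  have := degree_clonoid_monof p_pr minM (e := e); rewrite addn0 in Me.
  move=> /(_ Me); congr (degree_clonoid p M n _).
  by apply/ffunP => x; rewrite [RHS]ffunE big_nil mulr1.
pose e' j (i : 'I_n.+1) := (e i + (i == j))%N.
have -> : [ffun x => monof p e x * \prod_(d <- c :: s) linform d x] =
    [ffun x => \sum_j c j * [ffun x => monof p (e' j) x *
                                      \prod_(d <- s) linform d x] x].
  apply/ffunP => x; rewrite !ffunE big_cons mulrCA ffunE mulr_suml.
  apply: eq_bigr => j _; rewrite !ffunE -!mulrA; congr (_ * _).
  rewrite !mulrA; congr (_ * _).
  rewrite (bigD1 j) //= [in RHS](bigD1 j) //= /e' eqxx addn1 exprS mulrA.
  by congr (_ * _); apply: eq_bigr => i /negPf ->; rewrite addn0.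
apply: degree_clonoid_lincomb => // j _; apply: IHs.
rewrite /e' big_split /=.
suff -> : (\sum_(i < n.+1) (i == j) = 1)%N by rewrite addn1 addSnnS.
by rewrite (bigD1 j) //= eqxx big1 // => i /negPf ->.
Qed.

Lemma degree_clonoid_linear_subst (p : nat) (p_pr : prime p) (M : set nat)
    (minM : minor_subset p M) (n m : nat) (f : op p n.+1)
    (d : 'I_n.+1 -> 'I_m.+1 -> 'F_p) :
  degree_clonoid p M n f -> degree_clonoid p M m (linear_subst f d).
Proof.
move=> /(degree_clonoidP p_pr) Mf.
have -> : linear_subst f d =
    [ffun x => \sum_(a : expo p n.+1) coef a f * linear_subst (xpow a) d x].
  apply/ffunP => x; rewrite [RHS]ffunE linear_substE (coef_expansion p_pr).
  by apply: eq_bigr => a _; rewrite linear_substE.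
apply: degree_clonoid_lincomb => // a /Mf Ma.
(* x^a at linear forms is a product of weight a linear forms, the i-th one
   repeated a_i times. *)
pose s := flatten [seq nseq (a i) (d i) | i <- index_enum 'I_n.+1].
have size_s : size s = weight a.
  rewrite size_flatten sumnE !big_map /weight.
  by apply: eq_bigr => i _; rewrite size_nseq.
have := @degree_clonoid_prod_linform p p_pr M minM m s (fun=> 0%N).
rewrite big1 // add0n size_s => /(_ Ma); congr (degree_clonoid p M m _).
apply/ffunP => x; rewrite linear_substE !ffunE big1 // mul1r.
rewrite big_flatten big_map; apply: eq_bigr => i _.
by rewrite big_nseq ffunE -Monoid.iteropE ffunE.
Qed.

Lemma degree_clonoid_closed (p : nat) (p_pr : prime p) (M : set nat)
    (minM : minor_subset p M) :
  linearly_closed_clonoid (degree_clonoid p M).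
Proof.
split.
- by exists 0%N, 0; left.
- move=> m _ [n [f [g [/(linear_cloneP p_pr) [c ->] Mg ->]]]].
  have := degree_clonoid_lincomb p_pr (c := c) (f := g) (fun i _ => Mg i).
  congr (degree_clonoid p M m _).
  by apply/ffunP => x; rewrite !ffunE; apply: eq_bigr => i _; rewrite ffunE.
move=> m _ [n [f [g [Mf lin_g ->]]]].
have [d gE] := choice (fun i => (linear_cloneP p_pr (g i)).1 (lin_g i)).
have -> : g = (fun i => linform (d i)) by apply: functional_extensionality_dep.
exact: degree_clonoid_linear_subst.
Qed.

(** * Intersections, unions and injectivity *)

Lemma degree_clonoidI (p : nat) (p_pr : prime p) (M N : set nat) :
  degree_clonoid p (M `&` N)%classic =
  opset_inter (degree_clonoid p M) (degree_clonoid p N).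
Proof.
apply: functional_extensionality_dep => n; apply/seteqP; split=> f.
  by move=> /(degree_clonoidP p_pr) MNf;
     split; apply/(degree_clonoidP p_pr) => a /MNf [].
case=> /(degree_clonoidP p_pr) Mf /(degree_clonoidP p_pr) Nf.
by apply/(degree_clonoidP p_pr) => a nz; split; [exact: Mf | exact: Nf].
Qed.

(** A member for the union is split into its monomials with degree in M and
    the remaining ones. *)
Lemma degree_clonoidU (p : nat) (p_pr : prime p) (M N : set nat) :
  degree_clonoid p (M `|` N)%classic =
  opset_sum (degree_clonoid p M) (degree_clonoid p N).
Proof.
apply: functional_extensionality_dep => n; apply/seteqP; split=> f.
  move=> /(degree_clonoidP p_pr) MNf.
  pose inM (a : expo p n.+1) := `[< M (weight a) >].
  pose part (P : pred (expo p n.+1)) : op p n.+1 :=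
    [ffun x => \sum_a (if P a then coef a f else 0) * (xpow a : op p n.+1) x].
  exists (part inM), (part (predC inM)); split.
  - apply: degree_clonoid_lincomb => // a; case: ifP => [|_]; last by rewrite eqxx.
    by move=> /asboolP Ma _; apply/degree_clonoid_xpow.
  - apply: degree_clonoid_lincomb => // a; case: ifP => [|_]; last by rewrite eqxx.
    move=> /= /asboolP nMa /MNf MNa; apply/degree_clonoid_xpow => //.
    by case: MNa.
  apply/ffunP => x; rewrite (coef_expansion p_pr) !ffunE -big_split.
  apply: eq_bigr => a _; rewrite /= -mulrDl; congr (_ * _).
  by case: (inM a); rewrite ?addr0 ?add0r.
move=> [g [h [/(degree_clonoidP p_pr) Mg /(degree_clonoidP p_pr) Nh ->]]].
apply/(degree_clonoidP p_pr) => a; rewrite coefD => nz.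
have [g0|/Mg] := eqVneq (coef a g) 0; last by left.
by right; apply: Nh; move: nz; rewrite g0 add0r.
Qed.

Lemma degree_clonoid_sub (p : nat) (p_pr : prime p) (M N : set nat) :
  degree_clonoid p M = degree_clonoid p N -> (M `<=` N)%classic.
Proof.
move=> eqMN d; rewrite -(@weight_standard p d 0) //.
by move=> /(degree_clonoid_xpow p_pr); rewrite eqMN => /(degree_clonoid_xpow p_pr).
Qed.

(** * The lattice isomorphism *)

Lemma lattice_on_set_ring (T : Type) (L : set (set T)) :
  (forall A B, L A -> L B -> L (A `&` B)%classic) ->
  (forall A B, L A -> L B -> L (A `|` B)%classic) ->
  lattice_on L setI setU.
Proof.
move=> LI LU; split=> //.
- by move=> A B _ _; rewrite setIC.
- by move=> A B _ _; rewrite setUC.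
- by move=> A B C _ _ _; rewrite setIA.
- by move=> A B C _ _ _; rewrite setUA.
- by move=> A B _ _; rewrite setUC setKU.
- by move=> A B _ _; rewrite setIC setKI.
Qed.

(** Equational laws pass to images; this gives the lattice of clonoids,
    including the closure of clonoids under sums, without looking at
    clonoids again. *)
Lemma lattice_on_image (T U : Type) (L : set T) (meetL joinL : T -> T -> T)
    (K : set U) (meetK joinK : U -> U -> U) (phi : T -> U) :
  lattice_on L meetL joinL ->
  set_fun L K phi -> set_surj L K phi ->
  (forall x y, L x -> L y -> phi (meetL x y) = meetK (phi x) (phi y)) ->
  (forall x y, L x -> L y -> phi (joinL x y) = joinK (phi x) (phi y)) ->
  lattice_on K meetK joinK.
Proof.
move=> [LM LJ CM CJ AM AJ aM aJ] LK sLK phiM phiJ.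
split.
- by move=> _ _ /sLK [x Lx <-] /sLK [y Ly <-]; rewrite -phiM //; exact/LK/LM.
- by move=> _ _ /sLK [x Lx <-] /sLK [y Ly <-]; rewrite -phiJ //; exact/LK/LJ.
- by move=> _ _ /sLK [x Lx <-] /sLK [y Ly <-]; rewrite -!phiM // CM.
- by move=> _ _ /sLK [x Lx <-] /sLK [y Ly <-]; rewrite -!phiJ // CJ.
- move=> _ _ _ /sLK [x Lx <-] /sLK [y Ly <-] /sLK [z Lz <-].
  by rewrite -!phiM ?AM //; exact: LM.
- move=> _ _ _ /sLK [x Lx <-] /sLK [y Ly <-] /sLK [z Lz <-].
  by rewrite -!phiJ ?AJ //; exact: LJ.
- move=> _ _ /sLK [x Lx <-] /sLK [y Ly <-].
  by rewrite -phiJ // -phiM ?aM //; exact: LJ.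
- move=> _ _ /sLK [x Lx <-] /sLK [y Ly <-].
  by rewrite -phiM // -phiJ ?aJ //; exact: LM.
Qed.

Theorem theorem3p12 (p : nat) (p_prime : prime p) :
  lattice_isomorphism
    [set M : set nat | minor_subset p M]%classic
    (fun M N : set nat => M `&` N)%classic
    (fun M N : set nat => M `|` N)%classic
    [set C : opset p | linearly_closed_clonoid C]%classic
    (@opset_inter p)
    (@opset_sum p)
    (degree_clonoid p).
Proof.
have minors : lattice_on [set M : set nat | minor_subset p M]%classic
    (fun M N : set nat => M `&` N)%classic (fun M N : set nat => M `|` N)%classic.
  apply: lattice_on_set_ring => M N minM minN n.
    by move=> [Mn Nn] lt_pn; split; [exact: minM | exact: minN].
  by move=> [Mn|Nn] lt_pn; [left; exact: minM | right; exact: minN].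
have into : set_fun [set M : set nat | minor_subset p M]%classic
    [set C : opset p | linearly_closed_clonoid C]%classic (degree_clonoid p).
  by move=> M; exact: degree_clonoid_closed.
have onto : set_surj [set M : set nat | minor_subset p M]%classic
    [set C : opset p | linearly_closed_clonoid C]%classic (degree_clonoid p).
  move=> C clC; exists (weights C); first exact: weights_minor.
  exact: degree_clonoid_weights.
split=> //.
- apply: (lattice_on_image minors into onto) => M N _ _.
    exact: degree_clonoidI.
  exact: degree_clonoidU.
- split=> // M N _ _ eqMN.
  by apply/seteqP; split; apply: degree_clonoid_sub p_prime _ _ _.
- by move=> M N _ _; exact: degree_clonoidI.
- by move=> M N _ _; exact: degree_clonoidU.
Qed.
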